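(* Let $C_r$ ($r\ge 3$) be the directed cycle of length $r$. Then (a) $\chi^*_o(C_r)=3$ if $r\equiv 0 \pmod 3$; (b) $\chi^*_o(C_4)=4$; (c) $\chi^*_o(C_5)=5$; (d) $\chi^*_o(C_r)=4-\beta(r)$ if $r>5$ and $r\not\equiv 0\pmod 3$.
   Context: The directed cycle $C_r$ has vertices $u_i$, $i\in\mathbb{Z}/r\mathbb{Z}$, and arcs $u_iu_{i+1}$ (indices mod $r$). For a set $S$ of $k$ colors, a $b$-fold oriented $k$-coloring of an oriented graph $G$ is a map $f$ from $V(G)$ to the $b$-element subsets of $S$ such that (i) $f(x)\cap f(y)=\emptyset$ for every arc $xy$, and (ii) for all arcs $xy, zw$, $f(x)\cap f(w)\neq\emptyset$ implies $f(y)\cap f(z)=\emptyset$. $\chi^b_o(G)$ is the minimum such $k$, and $\chi^*_o(G)=\lim_{b\to\infty}\chi^b_o(G)/b=\inf_{b\ge1}\chi^b_o(G)/b$. A prime $p>3$ is type-A if $p\equiv 3 \pmod 4$. For an integer $r>5$: $\beta(r)=0$ if $r$ has no type-A prime factor, and otherwise $\beta(r)=\frac{4}{p+1}$ where $p$ is the least type-A prime factor of $r$. *)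

(* Defs.v *)
From HB Require Import structures.
From mathcomp Require Import all_boot all_order all_algebra.
From mathcomp Require Import all_classical all_reals.
Set Implicit Arguments. Unset Strict Implicit. Unset Printing Implicit Defensive.
Import Order.TTheory GRing.Theory Num.Theory.
Local Open Scope ring_scope.

Definition cyc_arc (r : nat) (x y : 'I_r) : bool := (val y == (val x).+1 %% r)%N.

Definition is_bfold_oriented_coloring (r b k : nat) (f : 'I_r -> {set 'I_k}) : Prop :=
  [/\ forall x, #|f x| = b,
      (forall x y, cyc_arc x y -> [disjoint f x & f y]) &
      (forall x y z w, cyc_arc x y -> cyc_arc z w ->
          ~~ [disjoint f x & f w] -> [disjoint f y & f z])].

Definition bfold_colorable (r b k : nat) : Prop :=
  exists f : 'I_r -> {set 'I_k}, is_bfold_oriented_coloring b f.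

(* chi^b_o(C_r): the minimum k admitting a b-fold oriented k-coloring
   (such a k always exists, e.g. k = b*r; the fallback value 0 is never used). *)
Definition chi_b (r b : nat) : nat :=
  match boolp.pselect (exists k, bfold_colorable r b k) with
  | left h => ex_minn (P := fun k => `[< bfold_colorable r b k >]%bool)
                (let: ex_intro k hk := h in ex_intro _ k (introT (boolp.asboolP _) hk))
  | right _ => 0%N
  end.

Definition chi_star (R : realType) (r : nat) : R :=
  inf [set ((chi_b r b)%:R / b%:R : R) | b in [set b : nat | (0 < b)%N]]%classic.

Definition typeA_prime (p : nat) : bool := [&& prime p, (3 < p)%N & (p %% 4 == 3)%N].

(* beta(r): 0 if no type-A prime factor, else 4/(p+1) with p the least one
   (primes r is sorted increasingly). *)
Definition beta (R : realType) (r : nat) : R :=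
  match [seq p <- primes r | typeA_prime p] with
  | [::] => 0
  | p :: _ => 4 / (p.+1)%:R
  end.

(* Main.v *)
Require Import Defs.
From mathcomp Require Import all_boot all_order all_algebra.
From mathcomp Require Import all_classical all_reals.
From mathcomp Require Import zify ring.
Set Implicit Arguments. Unset Strict Implicit. Unset Printing Implicit Defensive.
Import Order.TTheory GRing.Theory Num.Theory.
Local Open Scope ring_scope.

(** Extend a [b]-fold coloring [f] of [C_r] periodically to the integers and say
    that [x] and [y] overlap when [f x] and [f y] intersect.  The coloring
    conditions say exactly that [(x, y)] and [(x+1, y-1)] never both overlap.
    If [k < 4b], no four color sets are pairwise disjoint, and this forces the
    overlap relation to be translation invariant: it is given by a symmetric set
    [D] of differences.  The [h] with [h-1, h+1] both outside [D] form a subgroup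
    [nZ] containing [r], modulo which [D] is periodic; off this subgroup exactly
    one of [h-1, h+1] lies in [D], which forces [n = 3 mod 4] and
    [D = {0, 3 mod 4}] on [0, n).  Hence a color occurs at most [(n+1)/4] times
    among [n] consecutive vertices, so [k/b >= 4n/(n+1)], and [n] has a prime
    factor [p = 3 mod 4].  Conversely, for such [p] the intervals of length
    [(p+1)/4] in the circular tournament on [p] vertices color [C_p]. *)

(** * Difference sets and their periods *)

(** [dd_indep]: among 0, [a], [b], [c] some two differ by an element of [D]. The differences are
    variables tied by equations, so that instances can use simplified forms. *)
Record dense_difference_set (r : nat) (D : pred int) : Prop := DenseDifferenceSet {
  dd0 : D 0;
  ddN : forall d, D (- d) = D d;
  dd_shift2 : forall d, D d -> ~~ D (d + 2);
  dd_period : forall d, D (d + r%:Z) = D d;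
  dd_indep : forall a b c u v w, u = b - a -> v = c - a -> w = c - b ->
    ~~ D a -> ~~ D b -> ~~ D c -> ~~ D u -> ~~ D v -> ~~ D w -> False }.

(** These elements turn out to be periods of [D]. *)
Definition balanced (D : pred int) : pred int :=
  fun h => ~~ D (h - 1) && ~~ D (h + 1).

Section DifferenceSet.
Context (r : nat) (D : pred int) (DP : dense_difference_set r D).

Lemma dd_shiftN2 d : D d -> ~~ D (d - 2).
Proof.
rewrite -(ddN DP) => /(dd_shift2 DP); rewrite -(ddN DP).
by have -> : - (- d + 2) = d - 2 by lia.
Qed.

Lemma dd1 : ~~ D 1.
Proof.
apply/negP => D1; have := dd_shiftN2 D1.
by rewrite -(ddN DP) D1.
Qed.

Lemma dd2 : ~~ D 2.
Proof. exact: (dd_shift2 DP (dd0 DP)). Qed.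

Lemma balancedN h : balanced D (- h) = balanced D h.
Proof.
by rewrite /balanced -(ddN DP (h - 1)) -(ddN DP (h + 1)) !opprD opprK andbC.
Qed.

(** Otherwise 0, [h - 1], [h], [h + 1] would violate [dd_indep]. *)
Lemma balanced_in h : balanced D h -> D h.
Proof.
case/andP=> h1 h2; apply/negPn/negP => nh.
apply: (dd_indep DP (a := h - 1) (b := h) (c := h + 1) (u := 1) (v := 2) (w := 1));
  rewrite ?dd1 ?dd2 //; lia.
Qed.

(** If [d + h] were outside [D], then 0 and [d + h], together with [d + 1], [d + 2] or with [d - 1],
    [d - 2], would violate [dd_indep]; at least one of [d - 1], [d + 1] is outside [D] and decides
    the side. *)
Lemma dd_add_balanced d h : D d -> balanced D h -> D (d + h).
Proof.
move=> Dd Hh; have Dh := balanced_in Hh; case/andP: (Hh) => h1 h2.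
apply/negPn/negP => ndh.
have [D1|nD1] := boolP (D (d - 1)).
  have nD2 := dd_shift2 DP D1; have e2 : d - 1 + 2 = d + 1 by lia.
  rewrite e2 in nD2.
  apply: (dd_indep DP (a := d + h) (b := d + 1) (c := d + 2)
    (u := - (h - 1)) (v := - (h - 2)) (w := 1)); rewrite ?(ddN DP) ?dd1 //; try lia.
    exact: (dd_shift2 DP Dd).
  exact: dd_shiftN2.
apply: (dd_indep DP (a := d + h) (b := d - 1) (c := d - 2)
  (u := - (h + 1)) (v := - (h + 2)) (w := - 1)); rewrite ?(ddN DP) ?dd1 //; try lia.
  exact: dd_shiftN2.
exact: (dd_shift2 DP Dh).
Qed.

Lemma dd_addE d h : balanced D h -> D (d + h) = D d.
Proof.
move=> Hh; apply/idP/idP => [Ddh|Dd]; last exact: dd_add_balanced.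
have := dd_add_balanced Ddh (h := - h); rewrite balancedN => /(_ Hh).
by have -> : d + h - h = d by lia.
Qed.

Lemma balancedB g h : balanced D g -> balanced D h -> balanced D (g - h).
Proof.
move=> /andP[g1 g2] Hh; rewrite /balanced.
rewrite -(dd_addE (g - h - 1) Hh) -(dd_addE (g - h + 1) Hh).
have -> : g - h - 1 + h = g - 1 by lia.
have -> : g - h + 1 + h = g + 1 by lia.
by rewrite g1 g2.
Qed.

(* Away from the balanced elements, [D] is forced to alternate with step 2;
   starting from [D 0] and [~ D 1] this determines [D] below the least positive
   balanced element [n], and periodicity at [n] fixes [n] modulo 4. *)
Lemma dense_difference_set_structure : (0 < r)%N ->
  exists n : nat, [/\ (n %| r)%N, (n %% 4 = 3)%N &
    forall d : nat, (d < n)%N -> D d%:Z -> (d %% 4 == 0)%N || (d %% 4 == 3)%N].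
Proof.
move=> r0.
have Hr : balanced D r%:Z.
  by rewrite /balanced addrC (dd_period DP) (ddN DP) dd1 addrC (dd_period DP) dd1.
have exH : exists n : nat, (0 < n)%N && balanced D n%:Z.
  by exists r; rewrite r0.
case: (ex_minnP exH) => n /andP[n0 Hn] nmin; exists n.
have Hmod (m : nat) : balanced D m%:Z -> balanced D (m %% n)%:Z.
  elim/ltn_ind: m => m IH Hm; have [lt|le] := ltnP m n; first by rewrite modn_small.
  have := IH (m - n)%N; have -> : ((m - n) %% n = m %% n)%N.
    by rewrite -{2}(subnK le) modnDr.
  apply; first lia.
  have -> : (m - n)%:Z = m%:Z - n%:Z by lia.
  exact: balancedB.
have per d : D (d + n%:Z) = D d by exact: dd_addE.
have alt (d : nat) : (d <= n)%N -> D d%:Z = (d %% 4 == 0)%N || (d %% 4 == 3)%N.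
  elim/ltn_ind: d => -[|[|d]] IH dn; first by rewrite (dd0 DP).
    by rewrite (negbTE dd1).
  have nH : ~~ balanced D d.+1%:Z.
    by apply/negP => Hd; have := nmin d.+1; rewrite Hd /= => /(_ isT); lia.
  have Dd := IH d (ltnW (ltnSn _)) (ltnW (ltnW dn)).
  have dE : D d.+2%:Z = ~~ D d%:Z.
    have e1 : d.+1%:Z - 1 = d%:Z by lia.
    have e2 : d.+1%:Z + 1 = d.+2%:Z by lia.
    have e3 : d%:Z + 2 = d.+2%:Z by lia.
    move: nH; rewrite /balanced e1 e2.
    by case: (boolP (D d%:Z)) => [/(dd_shift2 DP)|_] /=; rewrite ?e3 ?negbK // => /negbTE.
  by rewrite dE Dd; lia.
split.
- have := Hmod _ Hr; case: (posnP (r %% n)) => [/eqP //|rn0] Hrn.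
  by have := nmin (r %% n)%N; rewrite Hrn rn0 => /(_ isT); rewrite leqNgt ltn_mod n0.
(* [D n] holds because [D 0] does, so [n] is 0 or 3 mod 4; [D (n - 1)] fails because [D (-1)] does,
   which excludes 0. *)
- have := alt n (leqnn n); rewrite -[n%:Z]add0r per (dd0 DP).
  have := alt n.-1 (leq_pred n); have -> : n.-1%:Z = -1 + n%:Z by lia.
  by rewrite per (ddN DP) (negbTE dd1); lia.
- by move=> d dn; rewrite alt // ltnW.
Qed.

End DifferenceSet.

(** * Periodic colorings of the integers and their overlap relation *)

(** [uc_swap] is the second coloring condition for the arcs from [x] to [x + 1] and from [y - 1] to
    [y]. *)
Record unrolled_coloring (r b k : nat) (F : int -> {set 'I_k}) : Prop :=
  UnrolledColoring {
    uc_card : forall x, #|F x| = b;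
    uc_period : forall x, F (x + r%:Z) = F x;
    uc_swap : forall x y,
      ~~ [disjoint F x & F y] -> [disjoint F (x + 1) & F (y - 1)] }.

Lemma bfold_colorable_unroll (r b k : nat) : (0 < r)%N ->
  bfold_colorable r b k -> exists F, @unrolled_coloring r b k F.
Proof.
case: r => // r _ [f [fb _ fswap]].
pose v (x : int) : 'I_r.+1 := inord `|(x %% r.+1%:Z)%Z|%N.
have vE x : (v x)%:Z = (x %% r.+1%:Z)%Z.
  have ge0 := modz_ge0 x (isT : r.+1%:Z != 0).
  rewrite /v inordK ?gez0_abs // -ltz_nat gez0_abs //.
  exact: (ltz_pmod x (isT : 0 < r.+1%:Z)).
have arc x : cyc_arc (v x) (v (x + 1)).
  rewrite /cyc_arc -eqz_nat vE.
  by rewrite -modz_nat -[(val (v x)).+1]addn1 PoszD vE modzDml.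
exists (f \o v); split => [x|x|x y]; first exact: fb.
  by congr f; apply: val_inj; apply/eqP; rewrite -eqz_nat !vE modzDr.
apply: fswap; first exact: arc.
by have := arc (y - 1); rewrite subrK.
Qed.

Lemma sum_card_pairwise_disjoint (I : Type) (T : finType) (F : I -> {set T}) (s : seq I) :
  pairwise (fun x y => [disjoint F x & F y]) s -> (\sum_(x <- s) #|F x| <= #|T|)%N.
Proof.
move=> ps; suff <- : #|\bigcup_(x <- s) F x| = (\sum_(x <- s) #|F x|)%N by exact: max_card.
elim: s ps => [|x s IH] /=; first by rewrite !big_nil cards0.
case/andP=> xs /IH sE; rewrite !big_cons -sE; apply/eqP.
rewrite (leq_card_setU _ _).2.
elim: s xs {IH sE} => [|y s IH] /=; first by rewrite big_nil -finset.setI_eq0 finset.setI0.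
case/andP=> xy /IH; rewrite big_cons -!finset.setI_eq0 finset.setIUr finset.setU_eq0 => ->.
by rewrite finset.setI_eq0 xy.
Qed.

Section Unrolled.
Context (r b k : nat) (F : int -> {set 'I_k}) (FP : unrolled_coloring r b F).

Definition overlap (x y : int) : bool := ~~ [disjoint F x & F y].

Lemma overlap_sym x y : overlap x y = overlap y x.
Proof. by rewrite /overlap disjoint_sym. Qed.

Lemma overlap_period x y : overlap x (y + r%:Z) = overlap x y.
Proof. by rewrite /overlap (uc_period FP). Qed.

Lemma overlap_swap x y : overlap x y -> ~~ overlap (x + 1) (y - 1).
Proof. by move/(uc_swap FP); rewrite /overlap negbK. Qed.

Context (b_gt0 : (0 < b)%N).

Lemma overlap_refl x : overlap x x.
Proof.
rewrite /overlap -finset.setI_eq0 finset.setIid -card_gt0 (uc_card FP); exact: b_gt0.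
Qed.

(** [overlap_swap] sends the pair [(x, x + 1)] to its mirror image. *)
Lemma overlapS x y : y = x + 1 -> ~~ overlap x y.
Proof.
move=> ->; apply/negP => xy; have := overlap_swap xy.
by rewrite addrK overlap_sym xy.
Qed.

(** [overlap_swap] sends the pair [(x, x + 2)] to [(x + 1, x + 1)]. *)
Lemma overlapSS x y : y = x + 2 -> ~~ overlap x y.
Proof.
move=> ->; apply/negP => /overlap_swap.
have -> : x + 2 - 1 = x + 1 by lia.
by rewrite overlap_refl.
Qed.

Lemma pairwise_not_overlap_le s : pairwise (fun x y => ~~ overlap x y) s -> (size s * b <= k)%N.
Proof.
move=> ps; have := @sum_card_pairwise_disjoint _ _ F s; rewrite card_ord.
rewrite (eq_bigr (fun=> b)) => [|x _]; last exact: (uc_card FP).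
rewrite big_const_seq count_predT iter_addn_0 mulnC; apply.
by apply: sub_pairwise ps => x y; rewrite /overlap negbK.
Qed.

Context (small : (k < 4 * b)%N).

Lemma no_four_disjoint x y z t :
  ~~ overlap x y -> ~~ overlap x z -> ~~ overlap x t ->
  ~~ overlap y z -> ~~ overlap y t -> ~~ overlap z t -> False.
Proof.
move=> xy xz xt yz yt zt.
have := @pairwise_not_overlap_le [:: x; y; z; t].
by rewrite /= xy xz xt yz yt zt => /(_ isT); rewrite leqNgt small.
Qed.

(* If [x] and [y] overlap but [x+1] and [y+1] do not, then the quadruples
   [x-1, x, x+1, y+1] and [y-1, y, y+1, x+1] force both [x, y+1] and [x+1, y]
   to overlap, which [overlap_swap] forbids. *)
Lemma overlap_shift1 x y : overlap x y -> overlap (x + 1) (y + 1).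
Proof.
move=> xy; apply: contraT => nxy; exfalso.
have n1 : ~~ overlap (x + 1) (y - 1) by exact: overlap_swap.
have n2 : ~~ overlap (x - 1) (y + 1).
  by rewrite overlap_sym; apply: overlap_swap; rewrite overlap_sym.
have m1 : overlap x (y + 1).
  apply: contraT => n3; exfalso.
  apply: (@no_four_disjoint (x - 1) x (x + 1) (y + 1)) => //;
    first [by apply: overlapS; lia | by apply: overlapSS; lia].
have m2 : overlap (x + 1) y.
  apply: contraT => n3; exfalso.
  apply: (@no_four_disjoint (y - 1) y (y + 1) (x + 1)); rewrite 1?(overlap_sym _ (x + 1)) //;
    first [by apply: overlapS; lia | by apply: overlapSS; lia].
by have /negP := overlap_swap m1; rewrite addrK; apply.
Qed.

Lemma overlap_shift (n : nat) x y : overlap x y -> overlap (x + n%:Z) (y + n%:Z).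
Proof.
elim: n => [|n IH] xy; first by rewrite !addr0.
by have := overlap_shift1 (IH xy); rewrite -!addrA -PoszD addn1.
Qed.

Context (r_gt0 : (0 < r)%N).

Lemma overlap_period_mul (n : nat) x y : overlap x (y + (n * r)%:Z) = overlap x y.
Proof.
elim: n => [|n IH]; first by rewrite addr0.
by rewrite mulSn addnC PoszD addrA overlap_period.
Qed.

Lemma overlapE x y : overlap x y = overlap 0 (y - x).
Proof.
(* Shifting back by [n] amounts to shifting forward by [n * r - n], since [n * r] is a period. *)
have shiftN (n : nat) u v : overlap (u + n%:Z) (v + n%:Z) -> overlap u v.
  move/(overlap_shift (n * r - n)).
  have -> : u + n%:Z + (n * r - n)%:Z = u + (n * r)%:Z by nia.
  have -> : v + n%:Z + (n * r - n)%:Z = v + (n * r)%:Z by nia.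
  by rewrite overlap_period_mul overlap_sym overlap_period_mul overlap_sym.
apply/idP/idP; case: x => n.
- by move=> h; apply: (shiftN n); rewrite add0r subrK.
- rewrite NegzE => /(overlap_shift n.+1).
  by rewrite addNr opprK.
- by move/(overlap_shift n); rewrite add0r subrK.
- rewrite NegzE => h; apply: (shiftN n.+1).
  by rewrite addNr; rewrite opprK in h.
Qed.

Lemma overlap_dense_difference_set : dense_difference_set r (overlap 0).
Proof.
split=> [|d|d|d|a c d u v w -> -> ->].
- exact: overlap_refl.
- by rewrite overlap_sym overlapE opprK add0r.
- move=> dd; apply/negP => /overlap_swap; rewrite overlapE.
  have -> : d + 2 - 1 - (0 + 1) = d by lia.
  by rewrite dd.
- exact: overlap_period.
- by rewrite -!overlapE; exact: no_four_disjoint.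
Qed.

End Unrolled.

(** * Lower bounds on the number of colors *)

(** Measured from the least element, offsets are [4q - 1] or [4q]. These two differ by 1, so each
    [q] is used at most once. *)
Lemma card_differences_0_3_mod4 (n : nat) (A : {set 'I_n}) : (n %% 4 = 3)%N ->
  (forall i j, i \in A -> j \in A -> (i <= j)%N ->
     ((j - i) %% 4 == 0)%N || ((j - i) %% 4 == 3)%N) ->
  (#|A| <= (n %/ 4).+1)%N.
Proof.
move=> n3 Adiff; have [->|[i0 i0A]] := set_0Vmem A; first by rewrite cards0.
case: (arg_minnP (fun i : 'I_n => val i) i0A) => i iA imin.
pose g (j : 'I_n) : 'I_(n %/ 4).+1 := inord ((j - i + 1) %/ 4).
have gE j : g j = ((j - i + 1) %/ 4)%N :> nat.
  by rewrite inordK //; have := ltn_ord j; lia.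
rewrite -[(n %/ 4).+1]card_ord -(@card_in_imset _ _ g A) ?max_card //.
move=> x y xA yA /(congr1 (@nat_of_ord _)); rewrite !gE => gxy; apply: val_inj => /=.
have := Adiff _ _ iA xA (imin _ xA); have := Adiff _ _ iA yA (imin _ yA).
have ix := imin _ xA; have iy := imin _ yA.
by case: (leqP x y) => [xy|/ltnW yx]; [have := Adiff _ _ xA yA xy | have := Adiff _ _ yA xA yx];
  move: ix iy gxy => /=; lia.
Qed.

(** Double counting of the pairs of a color and a vertex among [n] consecutive ones that carries
    it. *)
Lemma bfold_colorable_lt4 (r b k : nat) : (0 < r)%N -> (0 < b)%N -> (k < 4 * b)%N ->
  bfold_colorable r b k ->
  exists n : nat, [/\ (n %| r)%N, (n %% 4 = 3)%N & (n * b <= k * (n %/ 4).+1)%N].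
Proof.
move=> r0 b0 kb /(bfold_colorable_unroll r0)[F FP].
have [n [nr n3 nD]] :=
  dense_difference_set_structure (overlap_dense_difference_set FP b0 kb r0) r0.
exists n; split=> //.
have -> : (n * b = \sum_(i < n) #|F i%:Z|)%N.
  by rewrite (eq_bigr (fun=> b)) ?sum_nat_const ?card_ord // => i _; rewrite (uc_card FP).
under eq_bigr => i _ do rewrite -sum1_card big_mkcond.
rewrite exchange_big /= -[k in (_ <= k * _)%N]card_ord -sum_nat_const leq_sum // => c _.
rewrite -big_mkcond sum1_card -cardsE.
apply: card_differences_0_3_mod4 => // i j; rewrite !inE => ci cj ij.
apply: nD; first by have := ltn_ord j; lia.
rewrite -subzn // -(overlapE FP b0 kb r0); apply/pred0Pn; exists c.
by apply/andP; split; [exact: ci | exact: cj].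
Qed.

Lemma bfold_colorable_ge3 (r b k : nat) : (0 < r)%N -> (0 < b)%N ->
  bfold_colorable r b k -> (3 * b <= k)%N.
Proof.
move=> r0 b0 /(bfold_colorable_unroll r0)[F FP].
apply: (pairwise_not_overlap_le FP (s := [:: 0; 1; 2])) => /=.
rewrite !andbT; do ?[apply/andP; split];
  first [by apply: (overlapS FP); lia | by apply: (overlapSS FP); lia].
Qed.

(** Modulo 5 the differences 3 and 4 are -2 and -1, so all five color sets are pairwise disjoint. *)
Lemma bfold_colorable_C5 (b k : nat) : (0 < b)%N -> bfold_colorable 5 b k -> (5 * b <= k)%N.
Proof.
move=> b0 /(bfold_colorable_unroll (isT : 0 < 5)%N)[F FP].
have n3 x y : y = x + 3 -> ~~ overlap F x y.
  by move=> ->; rewrite overlap_sym -(overlap_period FP); apply: (overlapSS FP) => //; lia.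
have n4 x y : y = x + 4 -> ~~ overlap F x y.
  by move=> ->; rewrite overlap_sym -(overlap_period FP); apply: (overlapS FP) => //; lia.
apply: (pairwise_not_overlap_le FP (s := [:: 0; 1; 2; 3; 4])) => /=.
rewrite !andbT; do ?[apply/andP; split];
  first [by apply: (overlapS FP); lia | by apply: (overlapSS FP); lia
        | by apply: n3; lia | by apply: n4; lia].
Qed.

(** The least prime factor is odd. If it is 3 mod 4 it is type-A; if it is 1 mod 4, the cofactor is
    again 3 mod 4 and prime to 3. *)
Lemma typeA_prime_factor (n : nat) : (n %% 4 = 3)%N -> (n %% 3 != 0)%N ->
  exists2 p, (p %| n)%N & typeA_prime p.
Proof.
elim/ltn_ind: n => n IH n4 n3.
have n1 : (1 < n)%N by lia.
have [q4|q4] := eqVneq (pdiv n %% 4)%N 3%N.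
  exists (pdiv n); first exact: pdiv_dvd.
  rewrite /typeA_prime pdiv_prime // q4 eqxx andbT /=.
  have : (pdiv n != 3)%N by apply: contraNneq n3 => <-; rewrite -/(dvdn _ _) pdiv_dvd.
  lia.
have nE : (n = n %/ pdiv n * pdiv n)%N by rewrite divnK // pdiv_dvd.
have q2 : (2 <= pdiv n)%N by rewrite prime_gt1 // pdiv_prime.
have mn : (n %/ pdiv n < n)%N by rewrite ltn_Pdiv // ltnW.
have q1 : (pdiv n %% 4 = 1)%N.
  move: nE q4; set a := (n %/ _)%N; set q := pdiv n => nE q4.
  have : (q %% 2 = 1)%N by nia.
  lia.
have [||p pm pA] := IH _ mn.
- move: nE q1 {q4}; set a := (n %/ _)%N; set q := pdiv n => nE q1.
  by have := modnMmr a q 4; rewrite q1 muln1 -nE n4.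
- by apply: contra n3 => /eqP m3; rewrite nE -modnMml m3 mul0n mod0n.
by exists p => //; apply: dvdn_trans pm _; rewrite dvdn_div // pdiv_dvd.
Qed.

(** * Constructions of colorings *)

Lemma bfold_colorable_blowup (r b : nat) : (3 <= r)%N -> bfold_colorable r b (r * b).
Proof.
move=> r3.
pose f (x : 'I_r) : {set 'I_(r * b)} := [set c : 'I_(r * b) | (c %/ b == x)%N].
have meet x y : ~~ [disjoint f x & f y] -> x = y.
  case/pred0Pn => c /=; rewrite !inE => /andP[/eqP cx /eqP cy].
  by apply: val_inj; rewrite /= -cx -cy.
have noarc (x y : 'I_r) : cyc_arc x y -> x != y.
  move=> /eqP /= xy; apply/eqP => E; move: xy; rewrite E.
  have := ltn_ord y; case: (ltngtP y.+1 r) => // [lt|yr] _; first by rewrite modn_small //; lia.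
  by rewrite yr modnn; lia.
exists f; split.
- move=> x.
  have [b0|b0] := posnP b.
    have := max_card (f x); rewrite card_ord => le.
    have rb0 : (r * b = 0)%N by rewrite b0 muln0.
    lia.
  have lt (j : 'I_b) : (x * b + j < r * b)%N by have := ltn_ord x; have := ltn_ord j; nia.
  have -> : f x = [set Ordinal (lt j) | j : 'I_b].
    apply/setP => c; rewrite !inE; apply/eqP/imsetP => [cx|[j _ ->]] /=.
      exists (Ordinal (ltn_pmod c b0)) => //; apply: val_inj => /=.
      by rewrite -cx -divn_eq.
    by rewrite divnMDl // divn_small // addn0.
  by rewrite card_imset ?card_ord // => i j /(congr1 val) /= /addnI /val_inj.
- move=> x y xy; apply/negPn/negP => /meet E.
  by have := noarc _ _ xy; rewrite E eqxx.
(* A violation would give arcs in both directions between two vertices, impossible for [r >= 3]. *)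
- move=> x y z w /eqP /= xy /eqP /= zw /meet xw; apply/negPn/negP => /meet yz.
  move: xy zw; rewrite xw yz => -> ; rewrite -addn1 modnDml addn1.
  have := ltn_ord w; case: (ltngtP w.+2 r) => // [lt|lt|wr] _ wE.
  + by move: wE; rewrite modn_small //; lia.
  + have wr : (w.+1 = r)%N by have := ltn_ord w; lia.
    by move: wE; rewrite -addn1 wr modnDl modn_small; lia.
  + by move: wE; rewrite wr modnn; lia.
Qed.

(** A closed walk of length [r] in an oriented graph is a homomorphism from the cycle; the vertices
    visited serve as colors. *)
Lemma coloring_of_tournament_walk (r k : nat) (g : nat -> nat) (T : rel nat) :
  (0 < r)%N -> (forall i, (i < r)%N -> (g i < k)%N) ->
  (forall u v, T u v -> ~~ T v u) ->
  (forall i, (i.+1 < r)%N -> T (g i) (g i.+1)) -> T (g r.-1) (g 0%N) ->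
  bfold_colorable r 1 k.
Proof.
move=> r0 gk Tasym Tstep Tlast.
have arcT (x y : 'I_r) : cyc_arc x y -> T (g x) (g y).
  move=> /eqP /= ->; have := ltn_ord x; case: (ltngtP x.+1 r) => // [lt|E] _.
    by rewrite modn_small //; apply: Tstep.
  have rx : r.-1 = x by lia.
  by rewrite E modnn -rx.
pose f (x : 'I_r) : {set 'I_k} := [set Ordinal (gk x (ltn_ord x))].
have meet x y : ~~ [disjoint f x & f y] -> g x = g y.
  by case/pred0Pn => c /=; rewrite !inE => /andP[/eqP -> /eqP /(congr1 val)].
exists f; split=> [x|x y xy|x y z w xy zw /meet xw]; first exact: cards1.
- apply/negPn/negP => /meet E; have Txy := arcT _ _ xy.
  by have := Tasym _ _ Txy; move: Txy; rewrite E => ->.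
- apply/negPn/negP => /meet yz; have := Tasym _ _ (arcT _ _ xy).
  by rewrite xw yz (arcT _ _ zw).
Qed.

Lemma bfold_colorable_mod3 (r : nat) : (0 < r)%N -> (r %% 3 = 0)%N -> bfold_colorable r 1 3.
Proof.
move=> r0 r3.
apply: (@coloring_of_tournament_walk r 3 (fun i => i %% 3)%N
  (fun u v => v %% 3 == (u + 1) %% 3)%N) => //=.
- move=> i ?; lia.
- move=> u v; lia.
- move=> i ?; lia.
- by case: r r0 r3 => // r _ /= r3; rewrite mod0n; lia.
Qed.

(* A closed walk in the tournament 0 -> 1 -> 2 -> 0, 2 -> 3 -> 0: first [r %% 3]
   turns around the 4-cycle, then turns around the triangle. *)
Lemma bfold_colorable_4 (r : nat) : (5 < r)%N -> bfold_colorable r 1 4.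
Proof.
move=> r5.
(* [r - 4 * (r %% 3)] is a multiple of 3, and it is nonnegative since [r > 5]; it vanishes for
   [r = 8]. *)
pose g i := (if i < 4 * (r %% 3) then i %% 4 else (i - 4 * (r %% 3)) %% 3)%N.
pose T u v := (v == u.+1)%N || (v == 0)%N && (1 < u)%N.
have step d i : (2 < d)%N -> T (i %% d)%N (i.+1 %% d)%N.
  move=> d2; rewrite /T -addn1 -modnDml addn1.
  have : (i %% d < d)%N by rewrite ltn_mod; lia.
  rewrite leq_eqVlt => /predU1P[E|lt]; last by rewrite modn_small // eqxx.
  by rewrite E modnn /=; lia.
have T0 d i : (2 < d)%N -> (i.+1 %% d = 0)%N -> T (i %% d)%N 0%N.
  by move=> d2 E; have := step d i d2; rewrite E.
have c4 : (4 * (r %% 3) < r)%N || (4 * (r %% 3) == r)%N by lia.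
apply: (@coloring_of_tournament_walk r 4 g T); rewrite /g.
- lia.
- by move=> i _; case: ifP; lia.
- by move=> u v; rewrite /T; lia.
- move=> i ir; case: ifP => h1; case: ifP => h2; first exact: step.
  + have -> : (i.+1 - 4 * (r %% 3) = 0)%N by lia.
    by rewrite mod0n; apply: T0 => //; lia.
  + lia.
  + by rewrite subSn ?step //; lia.
- have -> : (if 0 < 4 * (r %% 3) then 0 %% 4 else (0 - 4 * (r %% 3)) %% 3)%N = 0%N.
    by rewrite sub0n !mod0n if_same.
  by case: ifP => h; apply: T0 => //; lia.
Qed.

Lemma eqn_mod_far (p s t : nat) : (t < s)%N -> (s < t + p)%N -> (t == s %[mod p])%N = false.
Proof.
move=> ts sp; rewrite eq_sym eqn_mod_dvd ?(ltnW ts) // gtnNdvd ?subn_gt0 //.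
by rewrite ltn_subLR // ltnW.
Qed.

(* The colors are the vertices of the circular tournament on [p = 4b - 1]
   vertices, and [u_i] receives the interval of length [b] starting at [i * b]. *)
Lemma bfold_colorable_circular (r p b : nat) : (p %| r)%N -> (0 < b)%N -> (p.+1 = 4 * b)%N ->
  bfold_colorable r b p.
Proof.
move=> pr b0 pE; have p0 : (0 < p)%N by move: b0 pE; clear; lia.
(* With offsets below [b], both differences lie strictly between 0 and [p = 4b - 1], hence are
   nonzero mod [p]. *)
have far (i i' j j' : nat) : (i < b)%N -> (i' < b)%N -> (j < b)%N -> (j' < b)%N ->
    ((i + j < b + b + (i' + j')) && (b + b + (i' + j') < i + j + p) &&
     (i < b + j) && (b + j < i + p))%N.
  by move: pE; clear; lia.
pose s (x : 'I_r) (j : 'I_b) : 'I_p := Ordinal (ltn_pmod (x * b + j) p0).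
have sE x y i j : s x i = s y j -> (x * b + i = y * b + j %[mod p])%N.
  by case.
(* Since [p] divides [r], the wraparound arc also advances the start by [b] mod [p]. *)
have arcE (x y : 'I_r) (j : nat) : cyc_arc x y -> (y * b + j = x * b + (b + j) %[mod p])%N.
  move=> /eqP /= ->; rewrite -modnDml -modnMml (modn_dvdm _ pr) modnMml modnDml.
  by rewrite mulSn [(b + _)%N]addnC addnA.
exists (fun x => [set s x j | j : 'I_b]); split.
- move=> x; rewrite card_imset ?card_ord // => i j /sE /eqP.
  have bp : (b <= p)%N by move: b0 pE; clear; lia.
  rewrite eqn_modDl !modn_small ?(leq_trans (ltn_ord _) bp) // => /eqP; exact: val_inj.
- move=> x y xy; apply/negPn/negP => /pred0Pn[c /andP[/imsetP[i _ ->] /imsetP[j _ /sE]]].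
  rewrite (arcE _ _ _ xy) => /eqP; rewrite eqn_modDl.
  have /andP[/andP[_ h1] h2] := far _ _ _ _ (ltn_ord i) (ltn_ord i) (ltn_ord j) (ltn_ord j).
  by rewrite eqn_mod_far.
- move=> x y z w xy zw /pred0Pn[c /andP[/imsetP[i _ ->] /imsetP[j _ /sE]]].
  rewrite (arcE _ _ _ zw) => E.
  apply/negPn/negP => /pred0Pn[c' /andP[/imsetP[i' _ ->] /imsetP[j' _ /sE]]].
  rewrite (arcE _ _ _ xy) => E'.
  (* Adding the two congruences cancels the starting points of the intervals. *)
  have : (x * b + z * b + (i + j') == x * b + z * b + (b + b + (i' + j)) %[mod p])%N.
    rewrite addnACA -modnDm E -E' modnDm; apply/eqP; congr (_ %% _)%N.
    by move: (x * b)%N (z * b)%N (i' : nat) (j : nat); clear; lia.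
  rewrite eqn_modDl.
  have /andP[/andP[/andP[h1 h2] _] _] :=
    far _ _ _ _ (ltn_ord i) (ltn_ord i') (ltn_ord j') (ltn_ord j).
  by rewrite eqn_mod_far.
Qed.

(** * The fractional oriented chromatic number *)

Lemma chi_bP (r b : nat) : (3 <= r)%N ->
  bfold_colorable r b (chi_b r b) /\
  (forall k, bfold_colorable r b k -> (chi_b r b <= k)%N).
Proof.
move=> r3; rewrite /chi_b; case: pselect => [h|[]]; last first.
  by exists (r * b)%N; exact: bfold_colorable_blowup.
case: ex_minnP => m /asboolP mc mmin; split=> // k kc.
by apply: mmin; apply/asboolP.
Qed.

Lemma chi_star_eq (R : realType) (r b k : nat) (x : R) : (3 <= r)%N -> (0 < b)%N ->
  bfold_colorable r b k -> k%:R / b%:R = x ->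
  (forall b' k', (0 < b')%N -> bfold_colorable r b' k' -> x * b'%:R <= k'%:R) ->
  chi_star R r = x.
Proof.
move=> r3 b0 bk <- lower; rewrite /chi_star; set S := (X in inf X).
have lb : lbound S (k%:R / b%:R).
  move=> _ [b' /= b'0 <-]; rewrite ler_pdivlMr ?ltr0n //.
  exact: lower b'0 (chi_bP b' r3).1.
have S0 : has_inf S by split; [exists ((chi_b r b)%:R / b%:R), b | exists (k%:R / b%:R)].
apply/eqP; rewrite eq_le lb_le_inf ?andbT //; last by case: S0.
apply: (le_trans (y := (chi_b r b)%:R / b%:R)).
  by apply: ge_inf; [case: S0 | exists b].
by rewrite ler_pM2r ?invr_gt0 ?ltr0n // ler_nat (chi_bP b r3).2.
Qed.

(** Fewer than [4 * b] colors would yield a divisor [n] of [r] that is 3 mod 4, and [n] has a type-A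
    prime factor. *)
Lemma bfold_colorable_ge4 (r b k : nat) : (0 < r)%N -> (0 < b)%N ->
  ~~ has typeA_prime (primes r) -> (r %% 3 != 0)%N ->
  bfold_colorable r b k -> (4 * b <= k)%N.
Proof.
move=> r0 b0 noA r3 bk; rewrite leqNgt; apply/negP => kb.
have [n [nr n4 _]] := bfold_colorable_lt4 r0 b0 kb bk.
have n3 : (n %% 3 != 0)%N by apply: contra r3; rewrite -!/(dvdn 3 _) => /dvdn_trans; apply.
have [p pn pA] := typeA_prime_factor n4 n3.
case/negP: noA; apply/hasP; exists p => //.
by rewrite mem_primes r0 (dvdn_trans pn nr) !andbT; case/and3P: pA.
Qed.

Lemma least_typeA_prime_le (r p q : nat) (s : seq nat) :
  [seq p <- primes r | typeA_prime p] = p :: s ->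
  q \in primes r -> typeA_prime q -> (p <= q)%N.
Proof.
move=> E qr qA.
have : q \in [seq p <- primes r | typeA_prime p] by rewrite mem_filter qA.
have : sorted leq [seq p <- primes r | typeA_prime p].
  apply: sorted_filter; first exact: leq_trans.
  exact: sub_sorted (ltnW) _ (sorted_primes r).
rewrite E inE => /= /(order_path_min leq_trans) /allP le.
by case/predU1P => [->|/le].
Qed.

Theorem theorem5 (R : realType) (r : nat) (hr : (3 <= r)%N) :
  [/\ ((r %% 3 == 0)%N -> chi_star R r = 3),
      chi_star R 4 = 4,
      chi_star R 5 = 5 &
      ((5 < r)%N -> (r %% 3 != 0)%N -> chi_star R r = 4 - beta R r)].
Proof.
have r0 : (0 < r)%N by lia.
split.
- move=> /eqP r3; apply: (chi_star_eq hr _ (bfold_colorable_mod3 r0 r3)); rewrite ?divr1 //.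
  by move=> b k b0 bk; rewrite -natrM ler_nat (bfold_colorable_ge3 r0 b0 bk).
- apply: (@chi_star_eq _ _ 1 4) => //; first exact: (@bfold_colorable_blowup 4 1).
    by rewrite divr1.
  by move=> b k b0 bk; rewrite -natrM ler_nat (bfold_colorable_ge4 _ b0 _ _ bk).
- apply: (@chi_star_eq _ _ 1 5) => //; first exact: (@bfold_colorable_blowup 5 1).
    by rewrite divr1.
  by move=> b k b0 bk; rewrite -natrM ler_nat (bfold_colorable_C5 b0 bk).
- move=> r5 r3; rewrite /beta.
  case E: [seq p <- primes r | typeA_prime p] => [|p s].
    rewrite subr0; apply: (chi_star_eq hr _ (bfold_colorable_4 r5)); rewrite ?divr1 //.
    move=> b k b0 bk; rewrite -natrM ler_nat (bfold_colorable_ge4 r0 b0 _ r3 bk) //.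
    by rewrite has_filter E.
  have : p \in [seq p <- primes r | typeA_prime p] by rewrite E mem_head.
  rewrite mem_filter mem_primes => /andP[/and3P[_ _ /eqP p4] /and3P[_ _ pr]].
  (* With [b = (p + 1) / 4] the circular coloring has ratio [4p / (p + 1) = 4 - 4 / (p + 1)]. *)
  have pE : (p.+1 = 4 * (p %/ 4).+1)%N by lia.
  apply: (chi_star_eq hr _ (bfold_colorable_circular pr (ltn0Sn _) pE)) => //.
    have : p.+1%:R = 4 * (p %/ 4).+1%:R :> R by rewrite pE natrM.
    have : (p %/ 4).+1%:R != 0 :> R by rewrite pnatr_eq0.
    rewrite -[p.+1%:R]natr1; move: (p%:R : R) ((p %/ 4).+1%:R : R) => x y y0 xy.
    have -> : x = 4 * y - 1 by rewrite -xy addrK.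
    by rewrite subrK; field; rewrite y0.
  move=> b k b0 bk; have [kb|kb] := leqP (4 * b) k.
    apply: (le_trans (y := 4 * b%:R)); last by rewrite -natrM ler_nat.
    by rewrite ler_wpM2r // gerBl divr_ge0.
  have [n [nr n4 nb]] := bfold_colorable_lt4 r0 b0 kb bk.
  have n3 : (n %% 3 != 0)%N by apply: contra r3; rewrite -!/(dvdn 3 _) => /dvdn_trans; apply.
  have [q qn qA] := typeA_prime_factor n4 n3.
  have pn : (p <= n)%N.
    apply: leq_trans (dvdn_leq _ qn); last by lia.
    apply: (least_typeA_prime_le E) => //.
    by rewrite mem_primes r0 (dvdn_trans qn nr) !andbT; case/and3P: qA.
  have nE : (n.+1 = 4 * (n %/ 4).+1)%N by lia.
  (* The bound for [n] rearranges to [n * (4 * b - k) <= k], where [n] may be replaced by the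
     smaller [p]. *)
  have key : (4 * p * b <= k * p.+1)%N.
    have nt : (n * (4 * b - k) <= k)%N.
      rewrite mulnBr leq_subLR addnC -mulSn mulnCA nE -mulnA leq_mul2l /=.
      by rewrite [((n %/ 4).+1 * k)%N]mulnC.
    have : (p * (4 * b - k) <= k)%N by apply: leq_trans nt; rewrite leq_mul2r pn orbT.
    by rewrite mulnBr leq_subLR addnC -mulSn mulnCA mulnA [(k * _)%N]mulnC.
  have P0 : 0 < p.+1%:R :> R by rewrite ltr0n.
  rewrite -(ler_pM2r P0) -natrM.
  have -> : (4 - 4 / p.+1%:R) * b%:R * p.+1%:R = (4 * p * b)%:R :> R.
    rewrite !natrM -natr1 in P0 *; field; exact: lt0r_neq0.
  by rewrite ler_nat.
Qed.
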